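(* Let $f,g:\mathbb{R}^n\to\mathbb{R}$ be two quadratic functions, $f(x)=x^TAx+a^Tx+p$ and $g(x)=x^TBx+b^Tx+q$, where $A,B$ are real symmetric $n\times n$ matrices, $a,b\in\mathbb{R}^n$ and $p,q\in\mathbb{R}$. Let $m\ge 1$, let $\Omega\subseteq\mathbb{R}^n$ be a convex set, and let $q_0,q_1,\ldots,q_m:\Omega\to\mathbb{R}$ be convex functions. Assume that there exist $\widetilde{x}\in\mathbb{R}^n$ and $\widetilde{z}\in\mathrm{relint}(\Omega)$ such that $g(\widetilde{x})+q_1(\widetilde{z})<0$ and $q_i(\widetilde{z})<0$ for $i=2,\ldots,m$. Then the following two statements are equivalent: (i) The system \[ f(x)+q_0(z)<0,\quad g(x)+q_1(z)\le 0,\quad q_i(z)\le 0\ (i=2,\ldots,m),\quad z\in\Omega \] has no solution $(x,z)$ with $x\in\mathbb{R}^n$. (ii) There exist $\mu_1,\ldots,\mu_m\ge 0$ such that \[ f(x)+\mu_1 g(x)+q_0(z)+\sum_{i=1}^m\mu_i q_i(z)\ge 0\quad\text{for all } x\in\mathbb{R}^n,\ z\in\Omega . \]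
   Context: $\mathrm{relint}(\Omega)$ denotes the set of relative interior points of the convex set $\Omega$. Quadratic functions are not assumed convex, and the matrices $A,B$ may be zero or indefinite. *)

(* Defs.v *)
From mathcomp Require Import all_boot all_order all_algebra.
From mathcomp Require Import all_classical all_reals all_analysis.

Set Implicit Arguments.
Unset Strict Implicit.
Unset Printing Implicit Defensive.
Import Order.TTheory GRing.Theory Num.Theory.
Import numFieldNormedType.Exports.

Local Open Scope classical_set_scope.
Local Open Scope ring_scope.

(* No sign condition is put on A: [quad A a p] is an arbitrary quadratic
   function, and it may degenerate to an affine one. *)
Definition quad (R : realType) (n : nat) (A : 'M[R]_n) (a : 'cV[R]_n) (p : R)
    (x : 'cV[R]_n) : R :=
  (x^T *m A *m x) 0 0 + (a^T *m x) 0 0 + p.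

Definition affine_set (R : realType) (n : nat) (M : set 'cV[R]_n) : Prop :=
  forall x y (t : R), M x -> M y -> M (t *: x + (1 - t) *: y).

Definition affine_hull (R : realType) (n : nat) (S : set 'cV[R]_n) :
    set 'cV[R]_n :=
  \bigcap_(M in [set M | affine_set M /\ S `<=` M]) M.

(* The conjunct [S x] is needed: away from the closure of the affine hull the
   second conjunct holds vacuously. *)
Definition relint (R : realType) (n : nat) (S : set 'cV[R]_n) : set 'cV[R]_n :=
  [set x | S x /\ within (affine_hull S) (nbhs x) S].

(* Main.v *)
Require Import Defs.
From mathcomp Require Import all_boot all_order all_algebra.
From mathcomp Require Import all_classical all_reals all_analysis.
From mathcomp Require Import ring lra.

(** Along the line through two points, [f] and [g] are univariate quadratics.
    For such a pair [phi], [psi] with [phi] not affine, and for [t] in (0, 1),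
    suitable weights on the two roots of [phi - (t * phi 1 + (1 - t) * phi 0)]
    give mean [t] and second moment [t], exactly as for the Bernoulli law on
    {0, 1}; so at one of the roots [psi] is at most
    [t * psi 1 + (1 - t) * psi 0].  Hence the joint range of two quadratics
    becomes convex after adding the nonnegative quadrant, and the tuple
    [(f + q_0, g + q_1, q_2, ..., q_m)] is convexlike in the sense of Ky Fan.
    Multipliers for a convexlike tuple are found one constraint at a time: the
    last constraint is first imposed strictly, then traded for a multiplier by a
    two-function argument. *)

Import Order.TTheory GRing.Theory Num.Theory.
Import numFieldNormedType.Exports.

Local Open Scope classical_set_scope.
Local Open Scope ring_scope.

(** Points with [h x < 0] bound [c] above by [L x / - h x], points with [h y > 0] bound it below by
    [- L y / h y]. Convexlikeness puts every lower bound under every upper one, so the infimum of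
    the upper bounds serves as [c]. *)
Lemma convexlike_pair_multiplier (R : realType) (T : Type) (X : set T)
    (L h : T -> R) :
  (forall (x y : T) (t : R), X x -> X y -> 0 <= t <= 1 ->
     exists2 w, X w & L w <= t * L x + (1 - t) * L y /\
                      h w <= t * h x + (1 - t) * h y) ->
  (exists2 x, X x & h x < 0) ->
  (forall x, X x -> h x < 0 -> 0 <= L x) ->
  exists2 c : R, 0 <= c & forall x, X x -> 0 <= L x + c * h x.
Proof.
move=> cvx [x0 Xx0 hx0] noneg.
have scaled x y (c d : R) : X x -> X y -> 0 < c -> 0 < d ->
    c * h x + d * h y < 0 -> 0 <= c * L x + d * L y.
  move=> Xx Xy c0 d0 hlt; have cd0 : 0 < c + d by lra.
  have t01 : 0 <= c / (c + d) <= 1.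
    apply/andP; split; first by rewrite divr_ge0 ?ltW.
    by rewrite ler_pdivrMr//; lra.
  have [w Xw [Lw hw]] := cvx x y _ Xx Xy t01.
  have mixE (u v : R) :
      c / (c + d) * u + (1 - c / (c + d)) * v = (c * u + d * v) / (c + d).
    by field; lra.
  move: Lw hw; rewrite !mixE => Lw hw.
  have hw0 : h w < 0.
    by apply: le_lt_trans hw _; rewrite pmulr_llt0 ?invr_gt0.
  have := le_trans (noneg w Xw hw0) Lw.
  by rewrite pmulr_lge0 ?invr_gt0.
have ratio x y : X x -> h x < 0 -> X y -> 0 < h y ->
    - L y / h y <= L x / - h x.
  move=> Xx hx Xy hy.
  rewrite ler_pdivrMr// mulrAC ler_pdivlMr ?oppr_gt0//.
  rewrite leNgt; apply/negP => lt.
  have Lx := noneg x Xx hx.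
  (* Weights [h y] on [x] and [- h x] on [y] cancel [h]. Raising the first by [e] makes the
     [h]-combination [e * h x < 0], while [e] is small enough to spend at most half of the assumed
     gap in [L]; the [+ 1] keeps the denominator positive. *)
  pose e := (- L y * - h x - L x * h y) / (2 * (L x + 1)).
  have e0 : 0 < e by rewrite divr_gt0//; lra.
  have eE : e * (L x + 1) * 2 = - L y * - h x - L x * h y.
    by rewrite /e; field; lra.
  have := scaled x y (h y + e) (- h x) Xx Xy.
  have eh : e * h x < 0 by rewrite pmulr_rlt0.
  have c0 : 0 < h y + e by lra.
  have d0 : 0 < - h x by lra.
  move=> /(_ c0 d0); nra.
pose S := [set r : R | exists x, [/\ X x, h x < 0 & r = L x / - h x]].
have S0 : S !=set0 by exists (L x0 / - h x0), x0.
have lbS : lbound S 0.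
  by move=> _ [x [Xx hx ->]]; rewrite divr_ge0 ?noneg//; lra.
exists (inf S); first exact: lb_le_inf.
move=> y Xy.
have [hy|hy|hy] := ltgtP (h y) 0.
- have : inf S <= L y / - h y by apply: ge_inf; [exists 0|exists y].
  by rewrite ler_pdivlMr; lra.
- have : - L y / h y <= inf S.
    by apply: lb_le_inf => // _ [x [Xx hx ->]]; apply: ratio.
  by rewrite ler_pdivrMr; lra.
- rewrite hy mulr0 addr0 leNgt; apply/negP => Ly.
  have Lx0 := noneg x0 Xx0 hx0.
  (* This weight on [y] brings the [L]-combination with [x0] to [-1]. *)
  have d0 : 0 < (L x0 + 1) / - L y by rewrite divr_gt0//; lra.
  have := scaled x0 y 1 ((L x0 + 1) / - L y) Xx0 Xy ltr01 d0.
  have -> : (L x0 + 1) / - L y * L y = - (L x0 + 1) by field; lra.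
  by rewrite hy; lra.
Qed.

Definition convexlike {R : realType} {T : Type} (X : set T)
    (h : nat -> T -> R) (k : nat) : Prop :=
  forall (x y : T) (t : R), X x -> X y -> 0 <= t <= 1 ->
    exists2 w, X w &
      forall i, (i <= k)%N -> h i w <= t * h i x + (1 - t) * h i y.

(** [X] stays general in the induction because imposing the last constraint strictly shrinks it to
    [X']. *)
Lemma convexlike_multipliers (R : realType) (T : Type) (h : nat -> T -> R)
    (k : nat) (X : set T) :
  convexlike X h k ->
  (exists2 x, X x & forall i, (1 <= i <= k)%N -> h i x < 0) ->
  (forall x, X x -> (forall i, (1 <= i <= k)%N -> h i x < 0) -> 0 <= h 0%N x) ->
  exists2 mu : nat -> R, (forall i, 0 <= mu i) &
    forall x, X x -> 0 <= h 0%N x + \sum_(1 <= i < k.+1) mu i * h i x.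
Proof.
elim: k X => [|k IH] X cvx [x0 Xx0 hx0] noneg.
  exists (fun=> 0) => // x Xx; rewrite big_geq// addr0.
  by apply: noneg => // i /andP[i1]; rewrite leqNgt i1.
have lek i : (1 <= i <= k)%N -> (1 <= i <= k.+1)%N.
  by case/andP=> -> /leqW.
pose X' := [set x | X x /\ h k.+1 x < 0].
have [||x [Xx hx] hxk|mu mu0 muP] := IH X'.
- move=> x y t [Xx hx] [Xy hy] t01.
  have [w Xw hw] := cvx x y t Xx Xy t01; exists w; last by move=> i /leqW/hw.
  split=> //; apply: le_lt_trans (hw _ (leqnn _)) _.
  (* Either weight may vanish, but one of them is at least 1/2, which gives strictness. *)
  case/andP: t01 => t0 t1; have [t2|t2] := leP t (1 / 2); nra.
- exists x0; first by split=> //; apply: hx0; rewrite leqnn.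
  by move=> i /lek/hx0.
- apply: noneg => // i /andP[i1]; rewrite leq_eqVlt ltnS => /predU1P[->//|ik].
  by apply: hxk; rewrite i1.
(* The Lagrangian of the first [k] constraints, nonnegative on [X'], plays the role of [L]; since
   [mu] is nonnegative, the same [w] serves for it. *)
have [x y t Xx Xy t01|||c c0 cP] := @convexlike_pair_multiplier R T X
    (fun x => h 0%N x + \sum_(1 <= i < k.+1) mu i * h i x) (h k.+1).
- have [w Xw hw] := cvx x y t Xx Xy t01; exists w => //.
  split; last exact: hw.
  rewrite !mulrDr addrACA; apply: lerD; first exact: hw.
  rewrite !mulr_sumr -big_split/= big_nat_cond [leRHS]big_nat_cond.
  apply: ler_sum => i /andP[/andP[_ ik] _].
  rewrite !(mulrCA _ (mu i)) -mulrDr.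
  by apply: ler_wpM2l => //; apply: hw; apply: ltnW.
- by exists x0 => //; apply: hx0; rewrite leqnn.
- by move=> x Xx hx; apply: muP.
exists (fun i => if i == k.+1 then c else mu i) => [i|x Xx]; first by case: ifP.
rewrite big_nat_recr//= eqxx addrA.
rewrite (eq_big_nat _ _ (F2 := fun i => mu i * h i x)); first exact: cP.
by move=> i /andP[_ ik]; rewrite ltn_eqF.
Qed.

Lemma bernoulli_le_of_lead_neq0 (R : realType) (al be al' be' t : R) :
  0 <= t <= 1 -> al != 0 ->
  exists l, al * l ^+ 2 + be * l <= t * (al + be) /\
            al' * l ^+ 2 + be' * l <= t * (al' + be').
Proof.
case/andP=> t0 t1 al0.
have tt : 0 <= t * (1 - t) by rewrite mulr_ge0// subr_ge0.
have [tt0|ttN0] := eqVneq (t * (1 - t)) 0.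
  have t2 : t ^+ 2 = t by rewrite expr2; lra.
  by exists t; rewrite t2; split; lra.
have {tt ttN0} tt : 0 < t * (1 - t) by rewrite lt0r ttN0.
(* The roots of [al * l ^+ 2 + be * l - t * (al + be)] are [t + d1], [t + d2]. *)
pose w := (2 * t * al + be) / al.
pose s := Num.sqrt (w ^+ 2 + 4 * (t * (1 - t))).
have s2 : s ^+ 2 = w ^+ 2 + 4 * (t * (1 - t)).
  by rewrite sqr_sqrtr// addr_ge0 ?sqr_ge0//; lra.
have s0 : 0 < s by rewrite sqrtr_gt0; have := sqr_ge0 w; lra.
pose d1 := (- w - s) / 2; pose d2 := (- w + s) / 2.
have wE : be = (w - 2 * t) * al by rewrite /w; field.
(* Substituting [l = t + d] and dividing by [al] gives this equation for [d], with discriminant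
   [s ^+ 2]. *)
have root d : d ^+ 2 + w * d = t * (1 - t) ->
    al * (t + d) ^+ 2 + be * (t + d) <= t * (al + be).
  move=> dE; rewrite wE le_eqVlt; apply/orP; left; apply/eqP.
  transitivity (al * (d ^+ 2 + w * d) + al * (t * (w - t))); first by ring.
  by rewrite dE; ring.
have r1 : d1 ^+ 2 + w * d1 = t * (1 - t).
  transitivity ((s ^+ 2 - w ^+ 2) / 4); first by rewrite /d1; field.
  by rewrite s2; field.
have r2 : d2 ^+ 2 + w * d2 = t * (1 - t).
  transitivity ((s ^+ 2 - w ^+ 2) / 4); first by rewrite /d2; field.
  by rewrite s2; field.
have prod : d1 * d2 = - (t * (1 - t)).
  transitivity ((w ^+ 2 - s ^+ 2) / 4); first by rewrite /d1 /d2; field.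
  by rewrite s2; field.
have d12 : d1 < d2 by rewrite /d1 /d2; lra.
have d1n : d1 < 0 by nra.
have d2p : 0 < d2 by nra.
pose k l := al' * l ^+ 2 + be' * l - t * (al' + be').
(* The positive weights [d2] and [- d1], once normalized, give the deviations [d1], [d2] mean 0 and
   variance [- (d1 * d2) = t * (1 - t)]. So [k] averages to 0 and cannot be positive at both
   roots. *)
have mean : d2 * k (t + d1) + (- d1) * k (t + d2) = 0.
  transitivity ((d2 - d1) * al' * (- (d1 * d2) - t * (1 - t))).
    by rewrite /k; ring.
  by rewrite prod opprK subrr mulr0.
have [k1|k1] := leP (k (t + d1)) 0.
  by exists (t + d1); split; [exact: root|rewrite -subr_le0].
exists (t + d2); split; first exact: root.
rewrite -subr_le0 -/(k _) leNgt; apply/negP => k2.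
have : 0 < d2 * k (t + d1) + (- d1) * k (t + d2).
  by rewrite addr_gt0// mulr_gt0//; lra.
by rewrite mean ltxx.
Qed.

Lemma bernoulli_le (R : realType) (al be al' be' t : R) :
  0 <= t <= 1 ->
  exists l, al * l ^+ 2 + be * l <= t * (al + be) /\
            al' * l ^+ 2 + be' * l <= t * (al' + be').
Proof.
move=> t01; have [al0|] := eqVneq al 0; last exact: bernoulli_le_of_lead_neq0.
have [al'0|al'0] := eqVneq al' 0.
  by exists t; rewrite al0 al'0; split; lra.
by have [l []] := @bernoulli_le_of_lead_neq0 R al' be' al be t t01 al'0; exists l.
Qed.

Lemma quad_on_line (R : realType) (n : nat) (A : 'M[R]_n) (a : 'cV[R]_n)
    (p : R) (x y : 'cV[R]_n) :
  exists al be, forall l,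
    quad A a p (y + l *: (x - y)) = al * l ^+ 2 + be * l + quad A a p y.
Proof.
move: (x - y) => d.
exists ((d^T *m A *m d) 0 0).
exists ((y^T *m A *m d) 0 0 + (d^T *m A *m y) 0 0 + (a^T *m d) 0 0) => l.
have trE : (y + l *: d)^T = y^T + l *: d^T by apply/matrixP => i j; rewrite !mxE.
rewrite /quad trE !(mulmxDl, mulmxDr) -!(scalemxAl, scalemxAr).
by rewrite !mxE; ring.
Qed.

Lemma quad_joint_range_convex (R : realType) (n : nat) (A B : 'M[R]_n)
    (a b : 'cV[R]_n) (p q : R) (x y : 'cV[R]_n) (t : R) :
  0 <= t <= 1 ->
  exists w, quad A a p w <= t * quad A a p x + (1 - t) * quad A a p y /\
            quad B b q w <= t * quad B b q x + (1 - t) * quad B b q y.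
Proof.
move=> t01.
have [al [be E]] := quad_on_line R n A a p x y.
have [al' [be' E']] := quad_on_line R n B b q x y.
have xE : x = y + 1 *: (x - y) by rewrite scale1r addrC subrK.
have [l [H H']] := bernoulli_le R al be al' be' t t01.
(* This point is on the line through [x] and [y], possibly outside the segment. *)
exists (y + l *: (x - y)).
by rewrite [in quad _ _ _ x]xE [in quad B _ _ x]xE !E !E'; split; lra.
Qed.

Theorem theorem3p2 (R : realType) (n m : nat)
    (A B : 'M[R]_n) (a b : 'cV[R]_n) (p q : R)
    (f g : 'cV[R]_n -> R)
    (hf : forall x, f x = quad A a p x) (hg : forall x, g x = quad B b q x)
    (Omega : set 'cV[R]_n) (qf : nat -> 'cV[R]_n -> R)
    (hm : (1 <= m)%N)
    (hA : A^T = A) (hB : B^T = B)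
    (hOmega : convex_set Omega)
    (hqf : forall i : nat, (i <= m)%N -> convex_function Omega (qf i))
    (hslater : exists x z : 'cV[R]_n, relint Omega z /\
       g x + qf 1%N z < 0 /\
       (forall i : nat, (2 <= i <= m)%N -> qf i z < 0)) :
  (~ exists x z : 'cV[R]_n, Omega z /\
       f x + qf 0%N z < 0 /\
       g x + qf 1%N z <= 0 /\
       (forall i : nat, (2 <= i <= m)%N -> qf i z <= 0))
  <->
  (exists mu : nat -> R,
     (forall i : nat, (1 <= i <= m)%N -> 0 <= mu i) /\
     (forall x z : 'cV[R]_n, Omega z ->
        0 <= f x + mu 1%N * g x + qf 0%N z
             + \sum_(1 <= i < m.+1) mu i * qf i z)).
Proof.
(* The constraints with index at least 2 do not involve [x], hence the default 0. *)
pose off (i : nat) (x : 'cV[R]_n) : R :=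
  if i is 0%N then f x else if i is 1%N then g x else 0.
pose h (i : nat) (u : 'cV[R]_n * 'cV[R]_n) : R := off i u.1 + qf i u.2.
have lagrangian (mu : nat -> R) x z :
    f x + mu 1%N * g x + qf 0%N z + \sum_(1 <= i < m.+1) mu i * qf i z =
    h 0%N (x, z) + \sum_(1 <= i < m.+1) mu i * h i (x, z).
  rewrite /h big_ltn// [in RHS]big_ltn//=.
  rewrite [in RHS](eq_big_nat _ _ (F2 := fun i => mu i * qf i z)); first by ring.
  by case=> [|[|i]]//= _; rewrite add0r.
split=> [nosol|[mu [mu0 muP]]].
- pose X := [set u : 'cV[R]_n * 'cV[R]_n | Omega u.2].
  have [[x1 z1] [x2 z2] t /= O1 O2 t01||[x z] Oz hxz|mu mu0 muP] :=
    @convexlike_multipliers R _ h m X.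
  + have [w [fw gw]] := quad_joint_range_convex R n A B a b p q x1 x2 t t01.
    case/andP: t01 => t0 t1; pose t' := Itv01 t0 t1.
    (* The two components are chosen independently: [w] from the joint range of [f] and [g], the
       other by convexity of [Omega] and of the [qf i]. *)
    exists (w, t *: z1 + (1 - t) *: z2).
      by have := hOmega z1 z2 t'; rewrite !inE; apply.
    move=> i im; rewrite /h /= !mulrDr addrACA; apply: lerD.
      by case: i im => [|[|i]] _ /=; rewrite ?hf ?hg// !mulr0 addr0.
    by apply: (hqf i im t'); rewrite inE.
  + have [x [z [[Oz _] [gz qz]]]] := hslater; exists (x, z) => //.
    by case=> [|[|i]]//= im; rewrite /h /= add0r; apply: qz.
  + rewrite leNgt; apply/negP => h0; apply: nosol; exists x, z.
    split=> //; split=> //; split; first by apply/ltW/(hxz 1%N).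
    by case=> [|[|i]]//= im; have /ltW := hxz i.+2 im; rewrite /h /= add0r.
  exists mu; split=> [i _|x z Oz]; first exact: mu0.
  by rewrite lagrangian; apply: muP.
case=> x [z [Oz [fx [gx qz]]]].
have := muP x z Oz; rewrite lagrangian leNgt => /negP; apply.
rewrite -[ltRHS]addr0; apply: ltr_leD => //.
rewrite big_nat_cond; apply: sumr_le0 => i /andP[im _].
apply: mulr_ge0_le0; first exact: mu0.
by case: i im => [|[|i]]// im; rewrite /h /= add0r; apply: qz.
Qed.
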